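(* Let $q$ be a prime power that is a cube (i.e. $q^{1/3}$ is a prime power). Suppose $F\subset\mathbb{F}_q$ is the subfield of cardinality $q^{1/3}$ and $V\subset\mathbb{F}_q$ is a two-dimensional vector space over $F$. If $A$ is a subset of $V$ such that $|A|>\sqrt{2}\,|V|^{7/8}=\sqrt{2}\,q^{7/12}$, then \[ |(A-A)(A-A)| = |VV| > \frac{q}{2}. \]
   Context: $\mathbb{F}_q$ is the finite field with $q$ elements. $(A-A)(A-A)=\{(a-b)(c-d):a,b,c,d\in A\}$ and $VV=\{uv:u,v\in V\}$, with products taken in $\mathbb{F}_q$. *)

(* Defs.v *)
From mathcomp Require Import all_boot all_order all_algebra all_field.
From mathcomp Require Import reals exp.

Set Implicit Arguments.
Unset Strict Implicit.
Unset Printing Implicit Defensive.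

Import GRing.Theory.
Local Open Scope ring_scope.

Definition diffset (K : finFieldType) (B C : {pred K}) : {set K} :=
  [set x - y | x in B, y in C].

Definition prodset (K : finFieldType) (B C : {pred K}) : {set K} :=
  [set x * y | x in B, y in C].

(* Main.v *)
(* Write r = #|F|.  Unique factorization of quadratics over F makes u v, with
   u, v in V, determine {u, v} up to scaling by F, so the fibres of
   multiplication on nonzero pairs of V have at most 2 (r - 1) elements; this
   gives |VV| > q / 2.

   To write u v with u, v in V as a product of two differences it suffices to
   find lam in F with lam u and v / lam both in A - A.  The numbers of pairs of A
   with difference lam u, or mu v, have nonnegative Fourier transforms, so
   counting the solutions of lam mu = 1 by Fourier analysis only needs the lower
   bound -2 sqrt r for Kloosterman sums, and |A| ^ 4 > 4 r ^ 7 is then exactly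
   what is required.

   For Weil's bound |K| <= 2 sqrt r: in a quadratic extension the Kloosterman
   sum becomes 2 r - K ^ 2.  If K ^ 2 > 4 r, then along a tower of quadratic
   extensions K ^ 2 / #|E| tends to infinity, whereas Stepanov's polynomial method
   bounds it uniformly. *)
Require Import Defs.
From mathcomp Require Import all_boot all_order all_algebra all_field.
From mathcomp Require Import all_fingroup all_character zify ring.
From mathcomp Require Import reals exp.

Set Implicit Arguments.
Unset Strict Implicit.
Unset Printing Implicit Defensive.

Import Order.TTheory GRing.Theory Num.Theory.
Local Open Scope ring_scope.

(** * Polynomial method *)

(** There are more polynomials than available coefficients, so the coefficient matrix has a nonzero
    left kernel, and any nonzero row of it is a relation. This supplies Stepanov's auxiliary
    polynomial. *)
Lemma poly_family_dependent (K : fieldType) n d (f : 'I_n -> {poly K}) :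
    (d < n)%N -> (forall i, (size (f i) <= d)%N) ->
  exists2 c : 'I_n -> K, exists i, c i != 0 & \sum_i c i *: f i = 0.
Proof.
move=> ltdn szf; pose A := \matrix_i (poly_rV (f i) : 'rV_d).
have kerA : kermx A != 0.
  rewrite -mxrank_eq0 mxrank_ker subn_eq0 -ltnNge.
  exact: leq_ltn_trans (rank_leq_col A) ltdn.
pose c := nz_row (kermx A).
have /eqP cA0 : c *m A == 0 by rewrite -sub_kermx nz_row_sub.
exists (c 0); first by apply/rV0Pn; rewrite nz_row_eq0.
have : \sum_i c 0 i *: (poly_rV (f i) : 'rV_d) = 0.
  by rewrite -[RHS]cA0 mulmx_sum_row; apply: eq_bigr => i _; rewrite rowK.
move/(congr1 rVpoly); rewrite linear_sum linear0 => cf0; apply: etrans cf0.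
by apply: eq_bigr => i _; rewrite linearZ /= poly_rV_K.
Qed.

(** The degrees are distinct, so the leading term at the largest index with [c i != 0] cannot
    cancel. *)
Lemma sum_graded_neq0 (K : fieldType) n d (f : 'I_n -> {poly K}) (c : 'I_n -> K) :
    (forall i, size (f i) = (i + d).+1) -> (exists i, c i != 0) ->
  \sum_i c i *: f i != 0.
Proof.
move=> szf [i0 ci0].
case: (@arg_maxnP _ i0 (fun i => c i != 0) val ci0) => i ci maxi.
apply/eqP => /(congr1 (coefp (i + d))); rewrite /coefp coef0 coef_sum.
rewrite (bigD1 i) //= big1 ?addr0 => [|j ji]; last first.
  rewrite coefZ; have [ltij|leji] := ltnP i j.
    have [->|/maxi] := eqVneq (c j) 0; first by rewrite mul0r.
    by rewrite /= leqNgt ltij.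
  rewrite nth_default ?mulr0 // szf ltn_add2r ltn_neqAle leji andbT.
  by apply: contraNneq ji => /val_inj ->.
move/eqP; rewrite coefZ mulf_eq0 (negPf ci) /=.
have := szf i => /(congr1 predn) /= <-.
by rewrite -lead_coefE lead_coef_eq0 -size_poly_eq0 szf.
Qed.

Lemma sum_pow_additive (K : comNzRingType) (n : nat) :
    (0 < n)%N -> {morph (fun x : K => x ^+ n) : x y / x + y} ->
  forall (I : Type) (s : seq I) (P : pred I) (f : I -> K),
    (\sum_(i <- s | P i) f i) ^+ n = \sum_(i <- s | P i) f i ^+ n.
Proof. by move=> n0 Dn I s P f; rewrite (big_morph _ Dn (expr0n _ n)) gtn_eqF. Qed.

Lemma pow_additive_iter (K : comNzRingType) (r m : nat) :
    {morph (fun x : K => x ^+ r) : x y / x + y} ->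
  {morph (fun x : K => x ^+ (r ^ m)) : x y / x + y}.
Proof.
move=> Dr; elim: m => [|m IH] x y; first by rewrite expn0 !expr1.
by rewrite expnSr !exprM IH Dr.
Qed.

(* The auxiliary polynomial is a combination of the products
   x ^ (i + k * M) * z ^ j, where z = \sum_(l < m.+1) (a x + b / x) ^ (r ^ l)
   and M = r ^ m.+1 = sqrt #|E|; on the points counted, z ^ M = s - z and
   x ^ (M * M) = x.  Its index t encodes (i, j, k) by t = i + j B + k M with
   B = r ^ m, and w = x ^ B z clears denominators. *)
Lemma stepanov_count (E : finFieldType) (r m : nat) (a b s : E) :
    (1 < r)%N -> (2 < m)%N ->
    {morph (fun x : E => x ^+ r) : x y / x + y} ->
    #|E| = (r ^ m.+1 * r ^ m.+1)%N -> a != 0 ->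
  (#|[set x : E | (x != 0)%R &&
      (\sum_(i < m.+1 + m.+1) (a * x + b / x) ^+ (r ^ i) == s)%R]|
    <= (r ^ m + 3) * r ^ m.+1)%N.
Proof.
move=> r1 m2 Dr cardQ a0; set S := [set x | _].
set B := (r ^ m)%N; set M := (r ^ m.+1)%N.
have r0 : (0 < r)%N by lia.
have B0 : (0 < B)%N by rewrite expn_gt0 r0.
have MrB : M = (r * B)%N by rewrite /M expnS.
have M4 : (4 < M)%N.
  rewrite /M; have : (2 ^ 4 <= r ^ m.+1)%N.
    by apply: (@leq_trans (2 ^ m.+1)); [rewrite leq_exp2l //; lia | rewrite leq_exp2r].
  lia.
have M0 : (0 < M)%N by lia.
have B2 : (2 * B <= M)%N by rewrite MrB leq_mul2r r1 orbT.
have DM : {morph (fun x : E => x ^+ M) : x y / x + y} by apply: pow_additive_iter.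
pose w : {poly E} := \sum_(i < m.+1)
  ((a ^+ (r ^ i))%:P * 'X^(B + r ^ i) + (b ^+ (r ^ i))%:P * 'X^(B - r ^ i)).
have leB (i : 'I_m.+1) : (r ^ i <= B)%N by rewrite leq_exp2l // -ltnS.
pose z x := \sum_(i < m.+1) (a * x + b / x) ^+ (r ^ i).
have wE x : x != 0 -> w.[x] = x ^+ B * z x.
  move=> x0; rewrite horner_sum mulr_sumr; apply: eq_bigr => i _.
  rewrite !hornerE ?hornerXn (pow_additive_iter _ Dr) !exprMn mulrDr exprD.
  rewrite exprVn mulrCA; congr (_ + _).
  by rewrite [RHS]mulrCA -expfB_cond // (negPf x0) /=; exact: leB.
have zS x : x \in S -> z x ^+ M = s - z x.
  rewrite inE => /andP[_ /eqP<-]; rewrite big_split_ord /= -/(z x) addrAC subrr add0r.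
  rewrite sum_pow_additive //; apply: eq_bigr => i _.
  by rewrite -exprM -expnD addnC.
have szwlow : (size (w - (a ^+ B)%:P * 'X^(B + B))%R <= B + B)%N.
  rewrite /w big_ord_recr /= -/B subnn expr0 mulr1 addrCA addrAC subrr add0r.
  apply: (leq_trans (size_polyD _ _)); rewrite geq_max; apply/andP; split.
    apply: (leq_trans (size_sum _ _ _)); apply/bigmax_leqP => i _.
    have ltB : (r ^ i < B)%N by rewrite ltn_exp2l.
    apply: (leq_trans (size_polyD _ _)); rewrite geq_max; apply/andP; split.
      by rewrite mul_polyC; apply: leq_trans (size_scale_leq _ _) _; rewrite size_polyXn; lia.
    by rewrite mul_polyC; apply: leq_trans (size_scale_leq _ _) _; rewrite size_polyXn; lia.
  by apply: leq_trans (size_polyC_leq1 _) _; lia.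
have szw : size w = (B + B).+1.
  have sztop : size ((a ^+ B)%:P * 'X^(B + B)) = (B + B).+1.
    by rewrite mul_polyC size_scale ?expf_neq0 // size_polyXn.
  by rewrite -[w](subrK ((a ^+ B)%:P * 'X^(B + B))) addrC size_polyDl sztop.
have w0 : w != 0 by rewrite -size_poly_eq0 szw.
(* [K] is the number of values of [k]. With [K = B + 2] the [n] unknowns outnumber the
   [(B + 1) M + K] available coefficients, because [B + 2 < M]. *)
pose K := (B + 2)%N; pose n := (M * K)%N.
pose j t := ((t %/ B) %% r)%N.
have j_lt t : (j t < r)%N by rewrite ltn_mod.
have jB t : (j t * B <= r.-1 * B)%N.
  by rewrite leq_mul2r -ltnS prednK ?j_lt ?orbT.
have tE t : t = (t %% B + j t * B + t %/ M * M)%N.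
  rewrite {1}(divn_eq t B) {1}(divn_eq (t %/ B) r) -divnMA -/(j t) MrB.
  by rewrite [(B * r)%N]mulnC; lia.
(* The padding [(r - 1 - j) B] compensates for the degree of [w ^ j]: for nonzero [x] the value is
   [x ^ ((r - 1) B)] times the intended product, and the degree is [t + (r - 1) B], distinct for
   distinct [t]. *)
pose e t := 'X^(t %% B + t %/ M * M + (r.-1 - j t) * B) * w ^+ j t.
have sze t : size (e t) = (t + r.-1 * B).+1.
  rewrite /e size_monicM ?monicXn ?expf_neq0 // size_polyXn.
  have := size_exp w (j t); rewrite szw /= => szwj.
  have : (0 < size (w ^+ j t))%N by rewrite size_poly_gt0 expf_neq0.
  have := tE t; have := jB t; rewrite mulnBl.
  rewrite mulnC mulnDr in szwj.
  by move: (j t * B)%N (r.-1 * B)%N (t %/ M * M)%N (t %% B)%N (size _) szwj; lia.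
pose v := s *: 'X^B - w.
have szv : (size v <= (B + B).+1)%N.
  apply: (leq_trans (size_polyD _ _)); rewrite geq_max size_polyN szw leqnn andbT.
  by apply: leq_trans (size_scale_leq _ _) _; rewrite size_polyXn; lia.
(* Up to a power of [x], this agrees on [S] with the [M]-th power of [e t]: [x ^ (k M M)] collapses
   to [x ^ k] and [z ^ (j M)] to [(s - z) ^ j], which keeps the degree small. *)
pose f (t : 'I_n) := 'X^(t %% B * M + t %/ M + (r.-1 - j t) * B) * v ^+ j t.
have szf t : (size (f t) <= B.+1 * M + K)%N.
  apply: (leq_trans (size_polyMleq _ _)); rewrite size_polyXn.
  have szvj : (size (v ^+ j t) <= ((B + B) * j t).+1)%N.
    apply: (leq_trans (size_poly_exp_leq _ _)); rewrite ltnS leq_mul2r.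
    by apply/orP; right; lia.
  have tK : (t %/ M < K)%N by rewrite ltn_divLR // mulnC; exact: ltn_ord.
  have tB : (t %% B < B)%N by rewrite ltn_mod.
  have : (t %% B * M <= B.-1 * M)%N by rewrite leq_mul2r -ltnS prednK ?tB ?orbT.
  have : (r.-1 * B + B = M)%N by rewrite MrB -{2}(prednK r0) mulSn addnC.
  have : (B.-1 * M + M = B * M)%N by rewrite -{2}(prednK B0) [RHS]mulSn addnC.
  have := jB t; move: szvj; rewrite mulnBl mulSn.
  have -> : ((B + B) * j t = j t * B + j t * B)%N by rewrite mulnC mulnDr.
  by move: (size _) (r.-1 * B)%N (t %% B * M)%N (j t * B)%N (B * M)%N (B.-1 * M)%N (t %/ M)%N tK => *; lia.
have ltdn : (B.+1 * M + K < n)%N.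
  rewrite /n /K mulSn mulnDr [(M * B)%N]mulnC.
  by move: (B * M)%N => X; lia.
have [c [t0 ct0] cf] := poly_family_dependent ltdn szf.
(* Since [c t ^ (M * M) = c t], the power [P ^ M] is the combination of the [e t ^ M] with
   coefficients [c t]; on [S] it is, up to powers of [x], the vanishing combination of the [f t]. *)
pose P := \sum_(t < n) (c t ^+ M) *: e t.
have P0 : P != 0.
  by apply: sum_graded_neq0 (fun t => sze t) _; exists t0; rewrite expf_neq0.
have szP : (size P <= n + M)%N.
  apply: (leq_trans (size_sum _ _ _)); apply/bigmax_leqP => t _.
  apply: leq_trans (size_scale_leq _ _) _; rewrite sze.
  have := ltn_ord t; have : (r.-1 * B <= M)%N by rewrite MrB leq_mul2r leq_pred orbT.
  lia.
have Mcard x : (x ^+ M) ^+ M = x :> E by rewrite -exprM -cardQ expf_card.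
have PS : all (root P) (enum S).
  apply/allP => x; rewrite mem_enum => xS.
  have x0 : x != 0 by move: xS; rewrite inE => /andP[].
  suff : x ^+ (r.-1 * B) * P.[x] ^+ M = 0.
    by move/eqP; rewrite mulf_eq0 expf_eq0 (negPf x0) andbF /= expf_eq0 M0.
  have : x ^+ (r.-1 * B * M) * (\sum_t c t *: f t).[x] = 0.
    by rewrite cf horner0 mulr0.
  move<-; rewrite !horner_sum sum_pow_additive // !mulr_sumr.
  apply: eq_bigr => t _; rewrite !hornerZ !exprMn Mcard [LHS]mulrCA [RHS]mulrCA.
  congr (_ * _); rewrite /e /f /v !hornerE wE //.
  rewrite /= [s * _]mulrC -mulrBr -zS // !exprMn [(z x ^+ M) ^+ _]exprAC !mulrA.
  congr (_ * _); rewrite -!exprM -!exprD.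
  have red u : x ^+ (u + t %/ M * M * M) = x ^+ (u + t %/ M).
    by rewrite !exprD !exprM Mcard.
  have <- : ((r.-1 - j t) * B + j t * B = r.-1 * B)%N by rewrite mulnBl subnK.
  move: (t %/ M)%N ((r.-1 - j t) * B)%N (t %% B)%N red => k d i red.
  transitivity (x ^+ ((d + j t * B) * M.+1 + i * M + k * M * M)).
    by congr (x ^+ _); lia.
  by rewrite red; congr (x ^+ _); lia.
suff : (#|S| < n + M)%N by move/ltnW/leq_trans; apply; rewrite /n /K; lia.
by rewrite [#|S|]cardE; apply: leq_trans (max_poly_roots P0 PS (enum_uniq _)) szP.
Qed.

(** * Kloosterman sums in quadratic extensions *)

Lemma big_preim_card (R : nmodType) (I J : finType) (h : I -> J) (g : J -> R) :
  \sum_i g (h i) = \sum_j g j *+ #|[set i | h i == j]|.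
Proof.
rewrite (partition_big h predT) //=; apply: eq_bigr => j _.
by rewrite (eq_bigr (fun=> g j)) => [|i /eqP-> //]; rewrite sumr_const cardsE.
Qed.

Definition nontrivial_char (F : finFieldType) (psi : F -> algC) :=
  [/\ psi 0 = 1, {morph psi : x y / x + y >-> x * y} & exists x, psi x != 1].

(** The additive group is abelian, so its irreducible characters are linear and number [#|F| > 1];
    one of them is not principal. *)
Lemma nontrivial_char_exists (F : finFieldType) :
  exists psi : F -> algC, nontrivial_char psi.
Proof.
have abF : abelian [set: F]%G.
  by apply/centsP => x _ y _; rewrite /commute !FinRing.zmodMgE addrC.
have lin i : 'chi[[set: F]%G]_i \is a linear_char by apply/char_abelianP.
have Nirr1 : (1 < Nirr [set: F]%G)%N.
  by have:= abF; rewrite NirrE card_classes_abelian => /eqP->; rewrite cardsT finNzRing_gt1.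
pose i := Ordinal Nirr1; exists 'chi_i; split.
- by rewrite -FinRing.zmod1gE lin_char1.
- by move=> x y; rewrite -FinRing.zmodMgE lin_charM ?inE.
apply/existsP; rewrite -negb_forall; apply/negP => /forallP chi1.
have /eqP : 'chi_i = 1 by apply/cfunP => x; rewrite cfun1E inE; apply/eqP.
by rewrite -irr0 (inj_eq irr_inj).
Qed.

Section NontrivialChar.

Variables (F : finFieldType) (psi : F -> algC).
Hypothesis charpsi : nontrivial_char psi.

Lemma nontrivial_char_norm x : `|psi x| = 1.
Proof.
case: charpsi => psi0 psiD _; have [p p_pr pF] := finPcharP F.
have psiMn n : psi (x *+ n) = psi x ^+ n.
  by elim: n => [|n IH]; rewrite ?mulr0n ?expr0 // mulrS psiD IH exprS.
apply/eqP; have := pexprn_eq1 p (normr_ge0 (psi x)).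
rewrite -normrX -psiMn -mulr_natr (pcharf0 pF) mulr0 psi0 normr1 eqxx.
by rewrite gtn_eqF ?prime_gt0.
Qed.

Lemma nontrivial_charN x : psi (- x) = (psi x)^*.
Proof.
case: charpsi => psi0 psiD _.
have px0 : psi x != 0 by rewrite -normr_eq0 nontrivial_char_norm oner_eq0.
apply: (mulfI px0); rewrite -psiD subrr psi0.
by rewrite -normCK nontrivial_char_norm expr1n.
Qed.

Lemma nontrivial_char_sum (c : F) :
  \sum_x psi (c * x) = if c == 0 then #|F|%:R else 0.
Proof.
case: charpsi => psi0 psiD [y psiy].
have [->|c0] := eqVneq c 0.
  by rewrite (eq_bigr (fun=> 1)) => [|x _]; rewrite ?sumr_const // mul0r psi0.
apply/eqP; have: psi y * (\sum_x psi (c * x)) == \sum_x psi (c * x).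
  rewrite mulr_sumr [eqbRHS](reindex_inj (addrI (y / c))) /=; apply/eqP.
  by apply: eq_bigr => x _; rewrite mulrDr psiD mulrCA divff // mulr1.
by rewrite -subr_eq0 -{2}[\sum_x _]mul1r -mulrBl mulf_eq0 subr_eq0 (negPf psiy).
Qed.

End NontrivialChar.

Definition kloosterman (F : finFieldType) (psi : F -> algC) (a b : F) : algC :=
  \sum_(x | x != 0) psi (a * x + b / x).

(** Substituting [- x] for [x] conjugates every term. *)
Lemma kloosterman_real (F : finFieldType) (psi : F -> algC) a b :
  nontrivial_char psi -> kloosterman psi a b \is Num.real.
Proof.
move=> charpsi; rewrite CrealE; apply/eqP; rewrite rmorph_sum /=.
rewrite [RHS](reindex_inj oppr_inj) /=; apply: eq_big => x.
  by rewrite oppr_eq0.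
by move=> _; rewrite -nontrivial_charN // invrN !mulrN opprD.
Qed.

Lemma finField_powD (F E : finFieldType) (iota : {rmorphism F -> E}) :
  {morph (fun x : E => x ^+ #|F|) : x y / x + y}.
Proof.
move=> x y; have [p p_pr pF] := finPcharP F.
apply: exprDn_pchar; rewrite (eq_pnat _ (pcharf_eq (rmorph_pchar iota pF))).
by have := pprimeChar_pgroup pF; rewrite /pgroup.pgroup cardsT.
Qed.

(** Over [F] the polynomial ['X^#|F| - 'X] is the product of all ['X - x], so its roots in [E] all
    come from [F]. *)
Lemma fixed_in_subfield (F E : finFieldType) (iota : {rmorphism F -> E}) (y : E) :
  y ^+ #|F| = y -> exists x, y = iota x.
Proof.
move=> yF; have := congr1 (map_poly iota) (finField_genPoly F).
move/(congr1 (horner^~ y)); rewrite rmorph_prod /= rmorphB /= map_polyXn map_polyX.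
rewrite !hornerE ?hornerXn yF subrr horner_prod => /esym/eqP/prodf_eq0[x _].
by rewrite rmorphB /= map_polyX map_polyC !hornerE subr_eq0 => /eqP->; exists x.
Qed.

Section QuadraticExtension.

Variables (F E : finFieldType) (iota : {rmorphism F -> E}).
Hypothesis cardE2 : #|E| = (#|F| ^ 2)%N.
Variables tr nm : E -> F.
Hypothesis trE : forall x, iota (tr x) = x + x ^+ #|F|.
Hypothesis nmE : forall x, iota (nm x) = x * x ^+ #|F|.

(* A monic quadratic over F has two roots in E, counted with multiplicity;
   they are conjugate over F exactly when it does not split over F. *)
Lemma trace_norm_count_le (p : F * F) :
  (#|[set x | (tr x, nm x) == p]|
   + #|[set u : F * F | (u.1 + u.2, u.1 * u.2)%R == p]| <= 2)%N.
Proof.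
case: p => t n; set S1 := [set x | _]; set S2 := [set u | _].
pose S3 := [set iota u.1 | u in S2].
have <- : #|S3| = #|S2|.
  apply: card_in_imset => -[u v] [u' v']; rewrite !inE /= !xpair_eqE.
  move=> /andP[/eqP uv _] /andP[/eqP uv' _] /fmorph_inj uu'.
  by congr (_, _) => //; apply: (addrI u); rewrite uv {1}uu' uv'.
have root1 x : x \in S1 -> x ^+ 2 - iota t * x + iota n = 0.
  by rewrite inE xpair_eqE => /andP[/eqP<- /eqP<-]; rewrite trE nmE; ring.
have root3 x : x \in S3 -> x ^+ 2 - iota t * x + iota n = 0.
  case/imsetP=> -[u v]; rewrite inE xpair_eqE /= => /andP[/eqP<- /eqP<-] ->.
  by rewrite rmorphD rmorphM; ring.
have [dis|] := boolP [disjoint S1 & S3].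
  pose P : {poly E} := 'X^2 - iota t *: 'X + (iota n)%:P.
  have szP : size P = 3%N.
    rewrite /P -addrA size_polyDl size_polyXn //.
    apply: leq_ltn_trans (size_polyD _ _) _; rewrite gtn_max size_polyN.
    rewrite (leq_ltn_trans (size_scale_leq _ _)) ?size_polyX //.
    by rewrite (leq_ltn_trans (size_polyC_leq1 _)).
  have P0 : P != 0 by rewrite -size_poly_eq0 szP.
  have rP : all (root P) (enum (S1 :|: S3)).
    apply/allP => x; rewrite mem_enum inE rootE /P !hornerE => xS.
    by apply/eqP; case/orP: xS => [/root1|/root3].
  have := max_poly_roots P0 rP (enum_uniq _); rewrite szP -cardE cardsU.
  by rewrite disjoint_setI0 // cards0 subn0.
(* A common element [x] lies in the image of [F], so its trace and norm are [2 x] and [x ^ 2]; the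
   quadratic is a square with sole root [x], and each set has at most one element. *)
case/pred0Pn => x /andP[/= x1 x3].
have sq y : y ^+ 2 - iota t * y + iota n = 0 -> y = x.
  case/imsetP: x3 => -[u v] _ /= xu.
  have xF : x ^+ #|F| = x by rewrite xu -rmorphXn /= expf_card.
  move: x1; rewrite inE xpair_eqE => /andP[/eqP<- /eqP<-].
  rewrite trE nmE xF => y0; apply/eqP; rewrite -subr_eq0 -sqrf_eq0 -y0.
  by apply/eqP; ring.
have le1 (S : {set E}) : {in S, forall y, y = x} -> (#|S| <= 1)%N.
  move=> Sx; rewrite -(cards1 x); apply/subset_leq_card/subsetP => y /Sx->.
  by rewrite inE.
by apply: (@leq_add _ _ 1 1); apply: le1 => y; [move/root1/sq | move/root3/sq].
Qed.

(** Each of the two families of fibres partitions a set of [#|F| ^ 2] elements, so the upper bounds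
    2, summed over the [#|F| ^ 2] pairs, are attained in total and hence one by one. *)
Lemma trace_norm_count (p : F * F) :
  (#|[set x | (tr x, nm x) == p]|
   + #|[set u : F * F | (u.1 + u.2, u.1 * u.2)%R == p]| = 2)%N.
Proof.
have cnt (I : finType) (h : I -> F * F) : (\sum_p #|[set i | h i == p]| = #|I|)%N.
  rewrite -[RHS]sum1_card (partition_big h predT) //=; apply: eq_bigr => j _.
  by rewrite -sum1_card; apply: eq_bigl => i; rewrite inE.
have le2 q := leqif_eq (trace_norm_count_le q).
have [_] := leqif_sum (P := predT) (fun q _ => le2 q).
rewrite big_split /= !cnt sum_nat_const card_prod cardE2.
rewrite -mulnn muln2 addnn eqxx => /esym/forallP/(_ p)/=.
by move/eqP.
Qed.

Lemma trace_quadraticZ (c : F) x : tr (iota c * x) = c * tr x.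
Proof.
apply: (fmorph_inj iota); rewrite rmorphM /= !trE exprMn -rmorphXn /= expf_card.
by rewrite mulrDr.
Qed.

Lemma trace_quadraticD : {morph tr : x y / x + y}.
Proof.
move=> x y; apply: (fmorph_inj iota); rewrite rmorphD /= !trE.
by rewrite (finField_powD iota) addrACA.
Qed.

(** The polynomial ['X^#|F| + 'X] has too few roots for the trace to vanish on [E]; by linearity
    over [F] the trace then takes every value. *)
Lemma nontrivial_char_trace (psi : F -> algC) :
  nontrivial_char psi -> nontrivial_char (psi \o tr).
Proof.
case=> psi0 psiD [c psic]; split => /=.
- suff -> : tr 0 = 0 by [].
  by apply: (fmorph_inj iota); rewrite trE rmorph0 expr0n add0r; case: #|F| (finNzRing_gt1 F).
- by move=> x y /=; rewrite trace_quadraticD psiD.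
have [x trx] : exists x, tr x != 0.
  apply/existsP; rewrite -negb_forall; apply/negP => /forallP tr0.
  pose P : {poly E} := 'X^#|F| + 'X.
  have szP : size P = #|F|.+1.
    by rewrite size_polyDl size_polyXn // size_polyX ltnS finNzRing_gt1.
  have P0 : P != 0 by rewrite -size_poly_eq0 szP.
  have rP : all (root P) (enum E).
    apply/allP => x _; rewrite rootE /P !hornerE addrC -trE.
    by rewrite (eqP (tr0 x)) rmorph0.
  have := max_poly_roots P0 rP (enum_uniq _); rewrite szP -cardE cardE2 ltnS.
  by rewrite leqNgt -{1}(expn1 #|F|) ltn_exp2l ?finNzRing_gt1.
by exists (iota (c / tr x) * x); rewrite trace_quadraticZ divfK.
Qed.

(** With [t] a trace or sum and [n] a norm or product, both [K_E] and [K_F ^ 2] sum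
    [psi ((a + b / n) t)]. Together they cover each pair [(t, n)] twice, and the sum over [t]
    vanishes unless [n = - b / a]. *)
Lemma kloosterman_quadratic (psi : F -> algC) (a b : F) :
    nontrivial_char psi -> a != 0 -> b != 0 ->
  kloosterman (psi \o tr) (iota a) (iota b) = 2 * #|F|%:R - kloosterman psi a b ^+ 2.
Proof.
move=> charpsi a0 b0; have [psi0 psiD _] := charpsi.
pose g (p : F * F) := if p.2 == 0 then 0 else psi ((a + b / p.2) * p.1).
have KE : kloosterman (psi \o tr) (iota a) (iota b) = \sum_x g (tr x, nm x).
  rewrite /kloosterman big_mkcond; apply: eq_bigr => x _ /=; rewrite /g /=.
  have -> : (nm x == 0) = (x == 0).
    by rewrite -(fmorph_eq0 iota) nmE -exprS expf_eq0.
  have [//|x0] := eqVneq x 0; congr psi; apply: (fmorph_inj iota).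
  have xF0 : x ^+ #|F| != 0 by rewrite expf_neq0.
  rewrite rmorphM rmorphD fmorph_div /= !trE nmE (finField_powD iota).
  rewrite !exprMn exprVn -!rmorphXn /= !expf_card.
  by field; rewrite xF0 x0.
have KF : kloosterman psi a b ^+ 2 = \sum_(u : F * F) g (u.1 + u.2, u.1 * u.2).
  rewrite expr2 /kloosterman big_distrlr /= pair_big /= big_mkcond.
  apply: eq_bigr => -[x y] _; rewrite /g /= mulf_eq0.
  have [//|x0] := eqVneq x 0; have [//|y0] := eqVneq y 0.
  by rewrite -psiD; congr psi; field; rewrite x0 y0.
apply: (canRL (addrK _)); rewrite KE KF !big_preim_card -big_split /=.
under eq_bigr do rewrite -mulrnDr trace_norm_count.
rewrite sumrMnl -[LHS]mulr_natl; congr (_ * _).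
rewrite -(pair_bigA _ (fun t n => g (t, n))) exchange_big /= (bigD1 (- b / a)) //=.
have c0 : - b / a != 0 by rewrite mulf_neq0 ?invr_eq0 ?oppr_eq0.
rewrite [X in _ + X]big1 ?addr0 => [|n nc]; rewrite /g /=.
  rewrite (negPf c0) nontrivial_char_sum // ifT //.
  by apply/eqP; field; rewrite oppr_eq0 ?a0 ?b0.
have [//|n0] := eqVneq n 0; first by rewrite big1.
rewrite nontrivial_char_sum // ifF //; apply: contraNF nc.
rewrite -(inj_eq (mulIf n0)) mulrDl divfK // mul0r addr_eq0 => /eqP an.
by rewrite -an mulrAC divff // mul1r.
Qed.

End QuadraticExtension.

(** * Weil's bound for Kloosterman sums *)

(* (x, y) |-> (x + y, xy) identifies (0, 1) and (1, 0), so it is not onto: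
   some monic quadratic has no root. *)
Lemma irreducible_quadratic_exists (F : finFieldType) :
  exists2 P : {poly F}, irreducible_poly P & size P = 3%N.
Proof.
pose h (u : F * F) := (u.1 + u.2, u.1 * u.2).
have [[t n] tnP] : exists p, p \notin codom h.
  apply/existsP; rewrite -negb_forall; apply/negP => /forallP hsurj.
  have /image_injP hinj : #|image h predT| == #|{: F * F}|.
    by apply/eqP/eq_card => p; rewrite hsurj.
  have /(hinj (0, 1) (1, 0) isT isT)/eqP : h (0, 1) = h (1, 0).
    by rewrite /h /= addrC mulrC.
  by rewrite xpair_eqE eq_sym oner_eq0.
pose P : {poly F} := 'X^2 - t *: 'X + n%:P.
have szP : size P = 3%N.
  rewrite /P -addrA size_polyDl size_polyXn //.
  apply: leq_ltn_trans (size_polyD _ _) _; rewrite gtn_max size_polyN.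
  rewrite (leq_ltn_trans (size_scale_leq _ _)) ?size_polyX //.
  by rewrite (leq_ltn_trans (size_polyC_leq1 _)).
exists P => //; apply: cubic_irreducible; rewrite ?szP // => x.
apply: contra tnP; rewrite rootE /P !hornerE => /eqP Px.
suff -> : (t, n) = h (x, t - x) by exact: codom_f.
rewrite /h /= addrC subrK; congr (_, _); apply/eqP; rewrite -subr_eq0 -Px.
by apply/eqP; ring.
Qed.

Lemma quadratic_extension_exists (F : finFieldType) :
  exists (E : finFieldType) (iota : {rmorphism F -> E}), #|E| = (#|F| ^ 2)%N.
Proof.
have [P irrP szP] := irreducible_quadratic_exists F.
have [L dimL _] := irredp_FAdjoin irrP.
exists (finvect_type L), (GRing.in_alg (finvect_type L)).
have := card_vspace {:finvect_type L}%VS; rewrite dimL szP => <-.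
by apply: eq_card => x; rewrite memvf.
Qed.

Lemma trace_norm_exist (F E : finFieldType) (iota : {rmorphism F -> E}) :
    #|E| = (#|F| ^ 2)%N ->
  exists tr nm : E -> F,
    (forall x, iota (tr x) = x + x ^+ #|F|) /\ (forall x, iota (nm x) = x * x ^+ #|F|).
Proof.
move=> cardE2; have FF (x : E) : (x ^+ #|F|) ^+ #|F| = x.
  by rewrite -exprM mulnn -cardE2 expf_card.
have /fin_all_exists[tr trE] (x : E) : exists y, iota y = x + x ^+ #|F|.
  have [|y ->] := @fixed_in_subfield _ _ iota (x + x ^+ #|F|); last by exists y.
  by rewrite (finField_powD iota) FF addrC.
have /fin_all_exists[nm nmE] (x : E) : exists y, iota y = x * x ^+ #|F|.
  have [|y ->] := @fixed_in_subfield _ _ iota (x * x ^+ #|F|); last by exists y.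
  by rewrite exprMn FF mulrC.
by exists tr, nm.
Qed.

(** This iterates the quadratic relation up a tower of quadratic extensions; [r ^ (2 ^ k')] is the
    cardinality of the field at height [k']. *)
Fixpoint kloosterman_lift (r k : nat) (K : algC) : algC :=
  if k is k'.+1 then 2 * (r ^ (2 ^ k'))%:R - kloosterman_lift r k' K ^+ 2 else K.

Lemma quadratic_tower (F : finFieldType) (psi : F -> algC) (a b : F) k :
    nontrivial_char psi -> a != 0 -> b != 0 ->
  exists (E : finFieldType) (iota : {rmorphism F -> E}) (tau : E -> F),
    [/\ #|E| = (#|F| ^ (2 ^ k))%N,
        forall x, iota (tau x) = \sum_(i < 2 ^ k) x ^+ (#|F| ^ i),
        nontrivial_char (psi \o tau)
      & kloosterman (psi \o tau) (iota a) (iota b)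
        = kloosterman_lift #|F| k (kloosterman psi a b)].
Proof.
move=> charpsi a0 b0; elim: k => [|k [E [iota [tau [cardE tauE chartau KE]]]]].
  exists F, idfun, id; split=> // x.
  by rewrite expn0 big_ord1 expr1.
have [E' [j cardE']] := quadratic_extension_exists E.
have [tr [nm [trE nmE]]] := trace_norm_exist j cardE'.
exists E', (j \o iota), (tau \o tr); split=> /=.
- by rewrite cardE' cardE -expnM expnSr.
- move=> x; rewrite tauE rmorph_sum /= expnS mul2n -addnn big_split_ord /=.
  rewrite -big_split /=; apply: eq_bigr => i _.
  rewrite rmorphXn /= trE (pow_additive_iter _ (finField_powD (j \o iota))).
  by rewrite cardE -exprM -expnD.
- exact: (nontrivial_char_trace cardE' trE chartau).
have := kloosterman_quadratic cardE' trE nmE (a := iota a) (b := iota b) chartau.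
by rewrite !fmorph_eq0 => /(_ a0 b0) ->; rewrite KE cardE.
Qed.

(** Upper bounds on the fibres suffice: as [psi] sums to zero, [N s] may be replaced by [N s - U].
    The deficits [U - N s] are nonnegative with total [r U - (M M - 1) = 3 r M + 1]. *)
Lemma kloosterman_weak_bound (F E : finFieldType) (iota : {rmorphism F -> E})
    (tau : E -> F) (psi : F -> algC) (a b : E) (m : nat) :
    nontrivial_char psi -> (2 < m)%N -> #|E| = (#|F| ^ m.+1 * #|F| ^ m.+1)%N ->
    (forall x, iota (tau x) = \sum_(i < m.+1 + m.+1) x ^+ (#|F| ^ i)) -> a != 0 ->
  `|kloosterman (psi \o tau) a b| <= (3 * #|F| * #|F| ^ m.+1).+1%:R.
Proof.
move=> charpsi m2 cardE2 tauE a0; set r := #|F|; set M := (r ^ m.+1)%N.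
pose N s := #|[set x : E | (x != 0) && (tau (a * x + b / x) == s)]|.
pose U := ((r ^ m + 3) * M)%N.
have leN s : (N s <= U)%N.
  apply: leq_trans (stepanov_count b (iota s) (finNzRing_gt1 F) m2 (finField_powD iota) cardE2 a0).
  apply/subset_leq_card/subsetP => x; rewrite !inE => /andP[-> /eqP<-] /=.
  by rewrite tauE.
have sumN : (\sum_s N s = (M * M).-1)%N.
  rewrite -cardE2 -(cardC1 (0 : E)) -[RHS]sum1_card.
  rewrite [RHS](partition_big (fun x => tau (a * x + b / x)) predT) //=.
  apply: eq_bigr => s _; rewrite /N -sum1_card; apply: eq_bigl => x.
  by rewrite !inE.
have KN : kloosterman (psi \o tau) a b = \sum_s psi s *+ N s.
  rewrite /kloosterman (partition_big (fun x => tau (a * x + b / x)) predT) //=.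
  apply: eq_bigr => s _; rewrite (eq_bigr (fun=> psi s)) => [|x /andP[_ /eqP->] //].
  by rewrite sumr_const; congr (_ *+ _); apply: eq_card => x; rewrite !inE.
have psi_sum : \sum_s psi s *+ U = 0.
  have := nontrivial_char_sum charpsi 1; rewrite oner_eq0 => psi1.
  by rewrite sumrMnl (eq_bigr (fun x => psi (1 * x))) ?psi1 ?mul0rn // => x; rewrite mul1r.
have -> : kloosterman (psi \o tau) a b = - \sum_s psi s *+ (U - N s).
  rewrite (eq_bigr _ (fun s _ => mulrnBr (psi s) (leN s))) sumrB psi_sum sub0r.
  by rewrite opprK.
rewrite normrN; apply: le_trans (ler_norm_sum _ _ _) _.
rewrite (eq_bigr (fun s => (U - N s)%:R)) => [|s _]; last first.
  by rewrite normrMn nontrivial_char_norm.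
rewrite -natr_sum ler_nat sumnB // sumN sum_nat_const -/r /U.
have -> : (r * ((r ^ m + 3) * M) = M * M + 3 * r * M)%N by rewrite /M expnS; ring.
by have : (0 < M * M)%N; [rewrite muln_gt0 expn_gt0 -/r (ltnW (finNzRing_gt1 F))|lia].
Qed.

(** If [y >= (4 + e) Q], then [(y - 2 Q) ^ 2 >= (2 + e) ^ 2 Q ^ 2 >= (4 + 4 e) Q ^ 2]: the excess
    over 4 at least quadruples at each level. *)
Lemma kloosterman_lift_growth (r k : nat) (K d : algC) :
    K \is Num.real -> 0 <= d -> (4 + d) * r%:R <= K ^+ 2 ->
  (4 + 4 ^+ k * d) * (r ^ (2 ^ k))%:R <= kloosterman_lift r k K ^+ 2.
Proof.
move=> Kreal d0 dK; elim: k => [|k IH] /=; first by rewrite expr0 mul1r.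
set Q := (r ^ (2 ^ k))%:R in IH *; set y := kloosterman_lift r k K ^+ 2 in IH *.
set e := 4 ^+ k * d in IH.
have e0 : 0 <= e by rewrite mulr_ge0 ?exprn_ge0.
have Q0 : 0 <= Q by rewrite ler0n.
have -> : (r ^ (2 ^ k.+1))%:R = Q ^+ 2 :> algC.
  by rewrite -natrX -expnM expnSr.
have le1 : (2 + e) * Q <= y - 2 * Q.
  by rewrite lerBrDr -mulrDl addrAC (_ : 2 + 2 = 4) // -natrD.
have : ((2 + e) * Q) ^+ 2 <= (y - 2 * Q) ^+ 2.
  by rewrite lerXn2r // nnegrE ?(le_trans _ le1) ?mulr_ge0 ?addr_ge0.
rewrite -[(2 * Q - y) ^+ 2]sqrrN opprB; apply: le_trans.
rewrite exprMn ler_wpM2r ?exprn_ge0 // exprS -mulrA -/e.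
have -> : (2 + e) ^+ 2 = 4 + 4 * e + e ^+ 2 by ring.
by rewrite lerDl exprn_ge0.
Qed.

Theorem kloosterman_bound (F : finFieldType) (psi : F -> algC) (a b : F) :
    nontrivial_char psi -> a != 0 -> b != 0 ->
  kloosterman psi a b ^+ 2 <= 4 * #|F|%:R.
Proof.
move=> charpsi a0 b0; set K := kloosterman psi a b; set r := #|F|.
have Kreal : K \is Num.real by exact: kloosterman_real.
have r0 : 0 < r%:R :> algC by rewrite ltr0n (ltnW (finNzRing_gt1 F)).
rewrite real_leNgt ?realX ?realM ?realn //; apply/negP => ltK.
pose d := K ^+ 2 / r%:R - 4.
have d0 : 0 < d by rewrite subr_gt0 ltr_pdivlMr.
have dK : (4 + d) * r%:R <= K ^+ 2 by rewrite addrC subrK divfK ?gt_eqF.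
(* The weak bound [3 r M + 1 <= (3 r + 1) M] yields [K' ^ 2 <= C #|E|] with [C] independent of the
   height. *)
pose C : algC := (3 * r + 1)%:R ^+ 2.
have C0 : 0 <= C / d by rewrite divr_ge0 ?exprn_ge0 ?ler0n // ltW.
(* A height above [C / d] forces [4 ^ k d > C], and [2 < k] gives the [2 < m] of the point count. *)
have [k kC k3] : exists2 k, (Num.bound (C / d) <= k)%N & (2 < k)%N.
  by exists (Num.bound (C / d) + 3)%N; rewrite ?leq_addr ?leq_addl.
have := kloosterman_lift_growth k Kreal (ltW d0) dK.
have [E [iota [tau [cardE tauE chartau <-]]]] := quadratic_tower k charpsi a0 b0.
pose m := (2 ^ k.-1).-1; have m1 : m.+1 = (2 ^ k.-1)%N by rewrite prednK ?expn_gt0.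
have m2 : (2 < m)%N.
  by rewrite -ltnS m1 -[4%N]/(2 ^ 2)%N leq_exp2l // -ltnS prednK // (ltn_trans _ k3).
have k2 : (2 ^ k)%N = (m.+1 + m.+1)%N.
  by rewrite m1 addnn -mul2n -expnS prednK // (ltn_trans _ k3).
rewrite k2 expnD in tauE cardE *.
have := kloosterman_weak_bound (iota b) charpsi m2 cardE tauE.
move=> /(_ (iota a)); rewrite fmorph_eq0 => /(_ a0).
set K' := kloosterman _ _ _ => leK'.
have K'real : K' \is Num.real by apply: kloosterman_real.
set M := (#|F| ^ m.+1)%N in leK' *.
have M0 : (0 < M)%N by rewrite expn_gt0 (ltnW (finNzRing_gt1 F)).
have : K' ^+ 2 <= C * (M * M)%:R.
  rewrite -real_normK // natrM -expr2 /C -exprMn lerXn2r ?nnegrE ?mulr_ge0 ?ler0n //.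
  by apply: le_trans leK' _; rewrite -natrM ler_nat mulnDl mul1n -addn1 leq_add2l.
move=> le1 le2; have := le_trans le2 le1.
have e0 : 0 <= 4 ^+ k * d by rewrite mulr_ge0 ?exprn_ge0 ?ler0n // ltW.
rewrite ler_pM2r ?ltr0n ?muln_gt0 ?M0 //; apply/negP.
rewrite -real_ltNge ?ger0_real ?addr_ge0 ?exprn_ge0 ?ler0n //.
apply: (@lt_le_trans _ _ (4 ^+ k * d)); last by rewrite lerDr ler0n.
rewrite -ltr_pdivrMr //; apply: lt_le_trans (archi_boundP C0) _.
rewrite -natrX ler_nat; apply: leq_trans kC _.
exact: ltnW (ltn_expl k (isT : 1 < 4)%N).
Qed.

(** * Differences along two directions *)

(** Unlike the two-sided bound, the lower bound survives degenerate arguments: the sum is -1 when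
    exactly one of [a], [b] vanishes, and nonnegative when both do. *)
Lemma kloosterman_ge (F : finFieldType) (psi : F -> algC) (a b : F) :
  nontrivial_char psi -> 0 <= kloosterman psi a b + 2 * sqrtC #|F|%:R.
Proof.
move=> charpsi; set s := sqrtC _.
have s2 : s ^+ 2 = #|F|%:R by rewrite sqrtCK.
have s1 : 1 <= s by rewrite -sqrtC1 ler_sqrtC ?qualifE /= ?ler01 ?ler0n // ler1n (ltnW (finNzRing_gt1 F)).
have s0 : 0 <= 2 * s by rewrite mulr_ge0 ?ler0n // (le_trans ler01).
have sum0 (c : F) : c != 0 -> \sum_(x | x != 0) psi (c * x) = -1.
  move=> c0; have := nontrivial_char_sum charpsi c; rewrite (negPf c0) (bigD1 0) //=.
  have [psi0 _ _] := charpsi.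
  by rewrite mulr0 psi0 => /eqP; rewrite addrC addr_eq0 => /eqP.
have axis (z : algC) : z = -1 -> 0 <= z + 2 * s.
  by move->; rewrite addrC subr_ge0 (le_trans s1) // ler_peMl ?ler1n // (le_trans ler01).
have [->|a0] := eqVneq a 0.
  have [->|b0] := eqVneq b 0.
    rewrite addr_ge0 //.
    rewrite /kloosterman sumr_ge0 // => x _; rewrite !mul0r addr0; have [-> _ _] := charpsi.
    exact: ler01.
  apply: axis; rewrite -(sum0 b b0) [RHS](reindex_inj invr_inj) /=.
  by apply: eq_big => x; rewrite ?invr_eq0 // mul0r add0r.
have [->|b0] := eqVneq b 0.
  by apply: axis; rewrite -(sum0 a a0); apply: eq_bigr => x _; rewrite mul0r addr0.
have Kreal := kloosterman_real a b charpsi.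
rewrite -[2 * s]opprK subr_ge0 lerNl.
apply: le_trans (real_ler_norm _) _; rewrite ?rpredN // normrN.
rewrite -(@ler_pXn2r _ 2) ?nnegrE // real_normK //.
apply: le_trans (kloosterman_bound charpsi a0 b0) _.
by rewrite exprMn s2 -natrX.
Qed.

(** Cauchy-Schwarz, by summing [2 n_i n_j <= n_i ^ 2 + n_j ^ 2] over all pairs. *)
Lemma sqr_sum_le (I : finType) (n : I -> nat) :
  ((\sum_i n i) ^ 2 <= #|I| * \sum_i n i ^ 2)%N.
Proof.
rewrite -(leq_pmul2l (isT : 0 < 2)%N) expnS expn1 big_distrlr /=.
have -> : (2 * (#|I| * \sum_i n i ^ 2) = \sum_i \sum_j (n i ^ 2 + n j ^ 2))%N.
  under [RHS]eq_bigr do rewrite big_split /= sum_nat_const.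
  by rewrite big_split /= sum_nat_const -big_distrr /= mul2n addnn.
rewrite big_distrr /= leq_sum // => i _; rewrite big_distrr /= leq_sum // => j _.
by rewrite nat_Cauchy.
Qed.

Section LineDifferences.

Variables (F : finFieldType) (psi : F -> algC) (T : finType) (A : {set T}).
Hypothesis charpsi : nontrivial_char psi.

(* The Fourier transform of the number of pairs (a, a') of A lying on a common
   fibre of alpha' with alpha a' - alpha a prescribed. *)
Definition line_spectrum (alpha alpha' : T -> F) (xi : F) : algC :=
  \sum_y `|\sum_(a in A | alpha' a == y) psi (xi * alpha a)| ^+ 2.

Variables alpha alpha' : T -> F.

Lemma line_spectrum_ge0 xi : 0 <= line_spectrum alpha alpha' xi.
Proof. by apply: sumr_ge0 => y _; rewrite exprn_ge0. Qed.

(** At frequency 0 the spectrum is the sum of the squared fibre sizes of [alpha'] on [A];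
    Cauchy-Schwarz applies over the [#|F|] fibres. *)
Lemma line_spectrum0_ge :
  #|A|%:R ^+ 2 <= #|F|%:R * line_spectrum alpha alpha' 0.
Proof.
pose n y := #|[set a in A | alpha' a == y]|.
have -> : line_spectrum alpha alpha' 0 = (\sum_y n y ^ 2)%:R.
  rewrite natr_sum; apply: eq_bigr => y _.
  rewrite (eq_bigr (fun=> 1)) => [|a _]; last first.
    by rewrite mul0r; have [-> _ _] := charpsi.
  rewrite sumr_const normr_nat -natrX; congr ((_ ^ 2)%:R).
  by apply: eq_card => a; rewrite !inE.
rewrite -natrX -natrM ler_nat; apply: leq_trans (sqr_sum_le n).
rewrite leq_exp2r // -sum1_card (partition_big alpha' predT) //=.
by apply: leq_sum => y _; rewrite /n -sum1_card; apply/eq_leq/eq_bigl => a; rewrite inE.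
Qed.

(** Fourier inversion: the squared modulus expands over pairs in a common fibre, and orthogonality
    in [xi] selects the shift [lam]. *)
Lemma line_spectrum_inversion lam :
  \sum_xi line_spectrum alpha alpha' xi * psi (xi * lam)
  = #|F|%:R * #|[set u in setX A A
      | (alpha' u.1 == alpha' u.2) && (alpha u.1 + lam == alpha u.2)]|%:R.
Proof.
have [psi0 psiD _] := charpsi.
have specE xi : line_spectrum alpha alpha' xi * psi (xi * lam) =
    \sum_(u in setX A A | alpha' u.1 == alpha' u.2)
       psi ((alpha u.1 + lam - alpha u.2) * xi).
  rewrite [RHS](partition_big (fun u => alpha' u.1) predT) //= mulr_suml.
  apply: eq_bigr => y _; rewrite normCK rmorph_sum big_distrlr /= mulr_suml.
  under [LHS]eq_bigr do rewrite mulr_suml.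
  rewrite pair_big_dep /=; apply: eq_big => [[a a']|[a a'] _] /=.
    rewrite in_setX /=; case: (a \in A) => //=; case: (a' \in A); rewrite ?andbF //=.
    by case: (alpha' a =P y) => [->|_]; rewrite ?andbF // andbT eq_sym.
  rewrite -nontrivial_charN // -!psiD; congr psi; ring.
under eq_bigr do rewrite specE.
rewrite exchange_big /=; under eq_bigr do rewrite nontrivial_char_sum //.
rewrite -big_mkcondr /= sumr_const mulr_natr; congr (_ *+ _).
by apply: eq_card => u; rewrite unfold_in !inE subr_eq0 -andbA.
Qed.

(** At shift 0, inversion counts pairs with equal coordinates, which injectivity reduces to the
    diagonal. *)
Lemma line_spectrum_sum :
    {in A &, injective (fun a => (alpha a, alpha' a))} ->
  \sum_xi line_spectrum alpha alpha' xi = #|F|%:R * #|A|%:R.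
Proof.
move=> inj; have [psi0 _ _] := charpsi.
have := line_spectrum_inversion 0.
under eq_bigr do rewrite mulr0 psi0 mulr1.
move=> ->; congr (_ * _%:R); rewrite -(card_in_imset (f := fun a => (a, a)) (D := mem A)).
  apply: eq_card => -[a a']; rewrite !inE /= addr0.
  apply/idP/imsetP => [/and3P[/andP[aA a'A] /eqP e' /eqP e]|[x xA [-> ->]]].
    by exists a => //; congr (_, _); apply: inj => //; rewrite e e'.
  by rewrite xA !eqxx.
by move=> a a' _ _ [].
Qed.

End LineDifferences.

(** Without a solution, the sum of [f xi * g eta * K(xi, eta)] is 0. Adding [2 s], with [s ^ 2 = r],
    to each [K] makes all terms nonnegative; keeping only [(0, 0)] gives
    [f 0 * g 0 * r <= 2 s (r n) ^ 2]. As [r * f 0] and [r * g 0] are at least [n ^ 2], it follows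
    that [n ^ 2 <= 2 s r ^ 3]. *)
Theorem reciprocal_differences (F : finFieldType) (T : finType) (A : {set T})
    (alpha alpha' beta beta' : T -> F) :
    {in A &, injective (fun a => (alpha a, alpha' a))} ->
    {in A &, injective (fun a => (beta a, beta' a))} ->
    (4 * #|F| ^ 7 < #|A| ^ 4)%N ->
  exists u v : T * T,
    [/\ u \in setX A A, v \in setX A A, alpha' u.1 = alpha' u.2,
        beta' v.1 = beta' v.2
      & (alpha u.1 - alpha u.2) * (beta v.1 - beta v.2) = 1].
Proof.
move=> inja injb ltA; have [psi charpsi] := nontrivial_char_exists F.
have [psi0 psiD _] := charpsi.
pose f := line_spectrum psi A alpha alpha'; pose g := line_spectrum psi A beta beta'.
pose inner (al al' : T -> F) lam := [set u in setX A A
      | (al' u.1 == al' u.2) && (al u.1 + lam == al u.2)].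
have [/existsP[lam /and3P[lam0]]|] := boolP [exists lam : F,
   [&& lam != 0, inner alpha alpha' lam != set0 & inner beta beta' lam^-1 != set0]].
  case/set0Pn=> u; rewrite inE => /and3P[uA /eqP u' /eqP ulam].
  case/set0Pn=> v; rewrite inE => /and3P[vA /eqP v' /eqP vlam].
  exists u, v; split=> //; rewrite -ulam -vlam !opprD !addNKr.
  by rewrite mulrNN divff.
rewrite negb_exists => /forallP none; exfalso; move: ltA; apply/negP; rewrite -leqNgt.
have fgK : \sum_xi \sum_eta f xi * g eta * kloosterman psi xi eta = 0.
  transitivity (\sum_(lam | lam != 0)
     (\sum_xi f xi * psi (xi * lam)) * (\sum_eta g eta * psi (eta * lam^-1))).
    under eq_bigr do under eq_bigr do rewrite mulr_sumr.
    under [RHS]eq_bigr do rewrite big_distrlr /=.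
    rewrite [RHS]exchange_big /=; apply: eq_bigr => xi _.
    rewrite [RHS]exchange_big /=; apply: eq_bigr => eta _.
    by apply: eq_bigr => lam _; rewrite psiD mulrACA.
  apply: big1 => lam lam0; rewrite !line_spectrum_inversion //.
  have := none lam; rewrite lam0 /= negb_and !negbK.
  by case/orP => /eqP; rewrite /inner => ->; rewrite cards0 !mulr0 ?mul0r.
pose s := sqrtC (#|F|%:R : algC); pose r := #|F|%:R : algC; pose n := #|A|%:R : algC.
have s2 : s ^+ 2 = r by rewrite sqrtCK.
have r0 : 0 < r by rewrite ltr0n (ltnW (finNzRing_gt1 F)).
have s1 : 1 <= s by rewrite -sqrtC1 ler_sqrtC ?qualifE /= ?ler01 ?ler0n // ler1n (ltnW (finNzRing_gt1 F)).
have f_ge0 := line_spectrum_ge0 psi A alpha alpha'.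
have g_ge0 := line_spectrum_ge0 psi A beta beta'.
have main : f 0 * g 0 * r <= 2 * s * ((r * n) * (r * n)).
  have <- : \sum_xi \sum_eta f xi * g eta * (kloosterman psi xi eta + 2 * s)
            = 2 * s * ((r * n) * (r * n)).
    rewrite -{1}(line_spectrum_sum charpsi inja) -(line_spectrum_sum charpsi injb).
    rewrite big_distrlr /= mulr_sumr -[RHS]add0r -[X in _ = X + _]fgK -big_split /=.
    apply: eq_bigr => xi _; rewrite mulr_sumr -big_split /=.
    by apply: eq_bigr => eta _; rewrite mulrDr [2 * s * _]mulrC.
  have term_ge0 xi eta : 0 <= f xi * g eta * (kloosterman psi xi eta + 2 * s).
    by rewrite mulr_ge0 ?kloosterman_ge // mulr_ge0.
  rewrite (bigD1 0) //= (bigD1 0) //= -addrA.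
  apply: (@le_trans _ _ (f 0 * g 0 * (kloosterman psi 0 0 + 2 * s))); last first.
    rewrite lerDl addr_ge0 ?sumr_ge0 // => xi _.
    by rewrite sumr_ge0.
  rewrite ler_wpM2l ?mulr_ge0 //.
  (* The missing 1 in [r - 1] is absorbed by [2 s >= 1]. *)
  have -> : kloosterman psi 0 0 = r - 1.
    rewrite /kloosterman (eq_bigr (fun=> 1)) => [|x _]; last by rewrite !mul0r addr0 psi0.
    by rewrite sumr_const cardC1 -subn1 natrB // (ltnW (finNzRing_gt1 F)).
  rewrite -addrA lerDl addrC subr_ge0 (le_trans s1) // ler_peMl ?ler1n //.
  exact: le_trans ler01 s1.
have [->//|A0] := posnP #|A|.
have n0 : 0 < n by rewrite ltr0n.
have s0 : 0 < s by apply: lt_le_trans ltr01 s1.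
have le1 : n ^+ 2 * n ^+ 2 <= (r * f 0) * (r * g 0).
  by rewrite ler_pM ?exprn_ge0 ?ler0n ?line_spectrum0_ge.
have le2 : n ^+ 2 * n ^+ 2 <= r * (2 * s * ((r * n) * (r * n))).
  apply: le_trans le1 _; rewrite (_ : _ * _ = r * (f 0 * g 0 * r)); last by ring.
  by rewrite ler_wpM2l // ltW.
have le3 : n ^+ 2 <= 2 * s * r ^+ 3.
  rewrite -(ler_pM2r (exprn_gt0 2 n0)); apply: le_trans le2 _.
  by rewrite le_eqVlt; apply/orP; left; apply/eqP; ring.
rewrite -(ler_nat algC) natrX natrM natrX -/n -/r.
have -> : n ^+ 4 = (n ^+ 2) ^+ 2 by rewrite -exprM.
have -> : 4 * r ^+ 7 = (2 * s * r ^+ 3) ^+ 2.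
  transitivity (4 * s ^+ 2 * r ^+ 6); first by rewrite s2 -mulrA -exprS.
  by move: (s) (r) => x y; ring.
rewrite lerXn2r // nnegrE ?exprn_ge0 ?ltW //.
by rewrite mulr_gt0 ?exprn_gt0 // mulr_gt0 // ltr0n.
Qed.

(** * Products of vectors of a plane *)

Lemma plane_basis (F : fieldType) (vT : vectType F) (V : {vspace vT}) (u w : vT) :
    \dim V = 2 -> u \in V -> w \in V -> u != 0 -> w \notin <[u]>%VS ->
  exists al be : vT -> F, {in V, forall x, x = al x *: u + be x *: w}.
Proof.
move=> dimV uV wV u0 wu; pose X := [tuple u; w].
have freeX : free X.
  rewrite (perm_free (Y := [:: w; u])) ?(perm_catC [:: u] [:: w]) // free_cons.
  by rewrite span_seq1 wu seq1_free.
have spanX : <<X>>%VS = V.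
  apply/eqP; rewrite eqEdim (eqnP freeX) dimV leqnn andbT.
  by apply/span_subvP => x; rewrite !inE => /orP[] /eqP->.
exists (coord X 0), (coord X 1) => x; rewrite -spanX => /coord_span xE.
rewrite {1}xE big_ord_recl big_ord1 /=.
by congr (_ *: _ + coord X _ x *: _); apply: val_inj.
Qed.

Lemma plane_not_line (F : fieldType) (vT : vectType F) (V : {vspace vT}) (u : vT) :
  \dim V = 2 -> exists2 w, w \in V & w \notin <[u]>%VS.
Proof.
move=> dimV; apply/subvPn; apply/negP => /dimvS; rewrite dimV dim_vline.
by case: (u != 0).
Qed.

(** These are coordinates in a basis of [V] whose first vector is [u]. *)
Lemma plane_coordinates (F : fieldType) (vT : vectType F) (V : {vspace vT}) (u : vT) :
    \dim V = 2 -> u \in V -> u != 0 ->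
  exists al al' : vT -> F,
    {in V &, injective (fun x => (al x, al' x))} /\
    {in V &, forall x y, al' x = al' y -> x - y = (al x - al y) *: u}.
Proof.
move=> dimV uV u0; have [w wV wu] := plane_not_line u dimV.
have [al [al' alE]] := plane_basis dimV uV wV u0 wu.
exists al, al'; split=> x y xV yV.
  by case=> e e'; rewrite (alE x xV) (alE y yV) e e'.
by move=> e; rewrite {1}(alE x xV) {1}(alE y yV) e opprD addrACA subrr addr0 scalerBl.
Qed.

Section CubicExtension.

Variables (F : fieldType) (L : fieldExtType F) (V : {vspace L}).
Hypotheses (dimL : \dim {:L} = 3) (dimV : \dim V = 2).

(** The degree of [x] divides the prime 3 and is 1 only in the base field. *)
Lemma size_minPoly_cubic (x : L) : x \notin 1%VS -> size (minPoly 1%VS x) = 4.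
Proof.
move=> x1; have := field_dimS (subvf <<1%AS; x>>%AS).
rewrite dim_Fadjoin dimv1 muln1 dimL size_minPoly => dvd3.
have := adjoin_deg_eq1 1%AS x; rewrite (negPf x1).
by have := dvdn_leq (isT : 0 < 3)%N dvd3; move: (adjoin_degree _ _) dvd3 => [|[|[|[|]]]].
Qed.

(* If u is not proportional to u0, then u and u0 span V and u v = u0 v0 is a
   quadratic equation over F for u / u0, which has degree 3. *)
Lemma plane_factorization (u v u0 v0 : L) :
    u \in V -> v \in V -> u0 \in V -> v0 \in V -> u0 != 0 -> v0 != 0 ->
  u * v = u0 * v0 -> (u \in <[u0]>%VS) || (u \in <[v0]>%VS).
Proof.
move=> uV vV u0V v0V u00 v00 uv; have [//|uu0] /= := boolP (u \in <[u0]>%VS).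
have [al [be abE]] := plane_basis dimV u0V uV u00 uu0.
have x1 : u / u0 \notin 1%VS.
  apply: contra uu0 => /vlineP[k ku]; apply/vlineP; exists k.
  by rewrite -[u](divfK u00) ku -scalerAl mul1r.
(* Expanding [v] and [v0] in the basis [u0], [u] and dividing [u v - u0 v0] by [u0 ^ 2] gives this
   polynomial in [u / u0]. *)
pose p : {poly L} := (be v)%:A *: 'X^2 + ((al v)%:A - (be v0)%:A) *: 'X - ((al v0)%:A)%:P.
have pF : p \is a polyOver 1%VS.
  rewrite rpredB ?rpredD ?polyOverZ ?polyOverXn ?polyOverX ?polyOverC ?rpredB //;
    by apply/vlineP; eexists.
have px : root p (u / u0).
  rewrite rootE; apply/eqP.
  have -> : p.[u / u0] =
      (u * ((al v)%:A * u0 + (be v)%:A * u) - u0 * ((al v0)%:A * u0 + (be v0)%:A * u)) / u0 ^+ 2.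
    by rewrite /p !hornerE /=; move: (be v)%:A (al v)%:A (be v0)%:A (al v0)%:A => *; field.
  by rewrite !mulr_algl -!abE // uv subrr mul0r.
have := minPoly_dvdp pF px; have [p0 _|p0 /(dvdp_leq p0)] := eqVneq p 0; last first.
  rewrite (size_minPoly_cubic x1) leqNgt ltnS.
  rewrite (leq_trans (size_polyD _ _)) // geq_max size_polyN.
  rewrite (leq_trans (size_polyC_leq1 _)) // andbT.
  rewrite (leq_trans (size_polyD _ _)) // geq_max.
  rewrite (leq_trans (size_scale_leq _ _)) ?size_polyXn //.
  by rewrite (leq_trans (size_scale_leq _ _)) ?size_polyX.
(* As [p = 0], its constant coefficient kills the [u0]-coordinate of [v0], so [v0] is a multiple of
   [u]. *)
have := congr1 (coefp 0) p0; rewrite /p /coefp coefB coefD !coefZ coefXn coefX coefC /=.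
rewrite coef0 !mulr0 !add0r => /eqP; rewrite oppr_eq0 scaler_eq0 oner_eq0 orbF => /eqP al0.
have := abE v0 v0V; rewrite al0 scale0r add0r => v0E.
have be0 : be v0 != 0 by apply: contraNneq v00 => be0; rewrite v0E be0 scale0r.
by apply/vlineP; exists (be v0)^-1; rewrite {2}v0E scalerA mulVf // scale1r.
Qed.

End CubicExtension.

Section PlaneProducts.

Variables (F : finFieldType) (L0 : fieldExtType F).
Local Notation L := (finvect_type L0).
Variable V : {vspace L}.
Hypotheses (dimL : \dim {:L} = 3) (dimV : \dim V = 2).

Let card_vspace_nz (U : {vspace L}) :
  #|[set x : L | (x \in U) && (x != 0)]| = (#|F| ^ \dim U).-1.
Proof.
rewrite -card_vspace (cardD1 0 U) mem0v.
by apply: eq_card => x; rewrite !inE andbC.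
Qed.

(** In the fibre over [u0 v0] the first factor determines the pair and lies on the line of [u0] or
    of [v0], each with [r - 1] nonzero points. *)
Lemma card_plane_products : (#|F| ^ 3 < 2 * #|prodset V V|)%N.
Proof.
set r := #|F|; pose V1 := [set x : L | (x \in V) && (x != 0)].
have cardV1 : #|V1| = (r ^ 2).-1 by rewrite card_vspace_nz dimV.
have r1 : (1 < r)%N := finNzRing_gt1 F.
pose W := [set p.1 * p.2 | p in setX V1 V1].
have fibre w : w \in W ->
    (#|[set p in setX V1 V1 | (p.1 * p.2 == w)%R]| <= 2 * r.-1)%N.
  case/imsetP=> -[u0 v0] /setXP[/= ]; rewrite !inE.
  move=> /andP[u0V u00] /andP[v0V v00] ->.
  pose line (z : L) := [set x : L | (x \in <[z]>%VS) && (x != 0)].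
  have cardline z : z != 0 -> #|line z| = r.-1.
    by move=> z0; rewrite card_vspace_nz dim_vline z0 expn1.
  rewrite mul2n -addnn -{1}(cardline _ u00) -(cardline _ v00).
  apply: leq_trans (leq_card_setU _ _); set S := [set p in _ | _].
  have <- : #|[set p.1 | p in S]| = #|S|.
    apply: card_in_imset => -[u v] [u' v']; rewrite !inE /=.
    move=> /andP[/andP[/andP[_ u_0] _] /eqP uv] /andP[_ /eqP uv'] uu'.
    by congr (_, _) => //; apply: (mulfI u_0); rewrite uv {1}uu' uv'.
  apply/subset_leq_card/subsetP => _ /imsetP[[u v] + ->]; rewrite !inE /=.
  move=> /andP[/andP[/andP[uV ->] /andP[vV _]] /eqP uv]; rewrite !andbT.
  exact: (plane_factorization dimL dimV uV vV u0V v0V u00 v00 uv).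
have leW : ((r ^ 2).-1 * (r ^ 2).-1 <= #|W| * (2 * r.-1))%N.
  rewrite -cardV1 -cardsX -sum1_card.
  rewrite (partition_big (fun p : L * L => p.1 * p.2) (mem W)) /=; last first.
    by move=> p pV; apply: imset_f.
  rewrite -sum_nat_const leq_sum // => w /fibre; apply: leq_trans.
  by rewrite -sum1_card; apply/eq_leq/eq_bigl => p; rewrite inE.
have ltW : (#|W| < #|prodset V V|)%N.
  apply: proper_card; apply/properP; split.
    apply/subsetP => w /imsetP[[u v] /setXP[/=]]; rewrite !inE.
    move=> /andP[uV _] /andP[vV _] ->.
    by apply/imset2P; exists u v.
  exists 0; first by apply/imset2P; exists 0 0; rewrite ?mem0v ?mul0r.
  apply/negP => /imsetP[[u v] /setXP[/=]]; rewrite !inE => /andP[_ u0] /andP[_ v0] /esym/eqP.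
  by rewrite mulf_eq0 (negPf u0) (negPf v0).
apply: leq_trans (_ : 2 * #|W|.+1 <= _)%N; last by rewrite leq_mul2l ltW.
(* With [r = t + 2], cancelling [r - 1] leaves [(r - 1) (r + 1) ^ 2 <= 2 w], and the left side is
   [r ^ 3 + r ^ 2 - r - 1 > r ^ 3]. *)
move: (#|W|) leW => w; move: (r) r1 => [|[|t]] // _.
have -> : (t.+2 ^ 2).-1 = (t.+1 * t.+3)%N by rewrite expnS expn1; lia.
rewrite [t.+2.-1]/=.
have -> : (w * (2 * t.+1) = t.+1 * (2 * w))%N by lia.
rewrite -mulnA leq_pmul2l // => le1; rewrite !expnS expn0.
by have := leq0n (t * t); lia.
Qed.

(** For nonzero [u] and [v], coordinates adapted to each turn reciprocal coordinate differences into
    differences [lam u] and [v / lam] of elements of [A], whose product is [u v]. *)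
Lemma plane_products_differences (A : {set L}) :
    A \subset V -> (4 * #|F| ^ 7 < #|A| ^ 4)%N ->
  prodset (diffset A A) (diffset A A) = prodset V V.
Proof.
move=> /subsetP AV ltA.
have inD x y : x \in A -> y \in A -> x - y \in diffset A A.
  by move=> xA yA; apply/imset2P; exists x y.
have [a0 a0A] : exists a0, a0 \in A.
  by apply/set0Pn; apply: contraTneq ltA => ->; rewrite cards0.
apply/eqP; rewrite eqEsubset; apply/andP; split; apply/subsetP => z.
  case/imset2P=> _ _ /imset2P[x y xA yA ->] /imset2P[x' y' x'A y'A ->] ->.
  by apply/imset2P; exists (x - y) (x' - y'); rewrite ?memvB // AV.
case/imset2P=> u v uV vV ->.
have [uv0|] := eqVneq (u * v) 0.
  by apply/imset2P; exists (a0 - a0) (a0 - a0); rewrite ?inD // subrr mul0r uv0.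
rewrite mulf_eq0 negb_or => /andP[u0 v0].
have [al [al' [inja alE]]] := plane_coordinates dimV uV u0.
have [be [be' [injb beE]]] := plane_coordinates dimV vV v0.
have [[x x'] [[y y'] [/setXP[/= xA x'A] /setXP[/= yA y'A] exx eyy prod1]]] :=
  reciprocal_differences (sub_in2 AV inja) (sub_in2 AV injb) ltA.
apply/imset2P; exists (x - x') (y - y'); rewrite ?inD //.
rewrite (alE x x') ?(beE y y') ?AV // -scalerAl -scalerAr scalerA.
by rewrite prod1 scale1r.
Qed.

End PlaneProducts.

(* The ambient field F_q is an extension L of the scalar field F, viewed as a
   finite field through finvect_type; {vspace _} are its F-subspaces. *)
Theorem theoremE (R : realType) (q : nat)
  (F : finFieldType) (L : fieldExtType F)
  (card_L : #|finvect_type L| = q)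
  (card_F : (#|F| ^ 3)%N = q)
  (V : {vspace finvect_type L}) (dim_V : \dim V = 2%N) :
  Num.sqrt 2 * #|V|%:R `^ (7 / 8) = Num.sqrt 2 * q%:R `^ (7 / 12) :> R /\
  forall A : {set finvect_type L},
    A \subset V ->
    Num.sqrt 2 * #|V|%:R `^ (7 / 8) < #|A|%:R :> R ->
    #|prodset (diffset A A) (diffset A A)| = #|prodset V V| /\
    q%:R / 2 < #|prodset V V|%:R :> R.
Proof.
have r1 : (1 < #|F|)%N := finNzRing_gt1 F.
have dimL : \dim {:finvect_type L} = 3.
  apply/eqP; rewrite -(eqn_exp2l _ _ r1) -card_vspace card_F -card_L.
  by apply/eqP/eq_card => x; rewrite memvf.
have cardV : #|V| = (#|F| ^ 2)%N by rewrite card_vspace dim_V.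
have powV : #|V|%:R `^ (7 / 8) = #|F|%:R `^ (7 / 4) :> R.
  rewrite cardV natrX -powR_mulrn // -powRrM; congr (_ `^ _).
  by rewrite (_ : 8 = 2 * 4) -?natrM //; field.
split.
  rewrite powV -card_F natrX -powR_mulrn // -powRrM; congr (_ * _ `^ _).
  by rewrite (_ : 12 = 3 * 4) -?natrM //; field.
move=> A AV ltA; split; last first.
  rewrite ltr_pdivrMr // -natrM ltr_nat mulnC -card_F.
  exact: card_plane_products.
rewrite (plane_products_differences dim_V AV) //.
rewrite -(ltr_nat R) natrM !natrX.
(* Since [#|V| = #|F| ^ 2], the threshold is [sqrt 2] times [#|F| ^ (7 / 4)], and its fourth power
   is an integer. *)
have -> : 4 * #|F|%:R ^+ 7 = (Num.sqrt 2 * #|V|%:R `^ (7 / 8)) ^+ 4 :> R.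
  rewrite exprMn powV -[_ `^ (7 / 4) ^+ 4]powR_mulrn ?powR_ge0 // -powRrM.
  rewrite divfK ?pnatr_eq0 // powR_mulrn // (exprM _ 2 2) sqr_sqrtr //.
  by congr (_ * _); rewrite -natrX.
by rewrite ltrXn2r // mulr_ge0 ?sqrtr_ge0 ?powR_ge0.
Qed.
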